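(* There is an absolute constant $C>0$ such that for every $n\ge2$ and every Banach space $X$ with $\dim(X)=n$, $$T_2(X)\le C\, I_2(X)\,\log^{3/2} n .$$
   Context: Banach spaces are real. $T_2(X)$ (the Gaussian type $2$ constant) is the best constant $M$ such that $\mathbb{E}\|\sum_{i=1}^m g_i x_i\|\le M(\sum_{i=1}^m\|x_i\|^2)^{1/2}$ for all $m$ and all $x_1,\dots,x_m\in X$, where the $g_i$ are independent standard Gaussian variables. $I_2(X)$ (the infratype $2$ constant) is the best constant $M$ such that $\min_{\eta_i=\pm1}\|\sum_{i=1}^m\eta_i x_i\|\le M(\sum_{i=1}^m\|x_i\|^2)^{1/2}$ for all $m$ and all $x_1,\dots,x_m\in X$. $\log^{3/2}n$ means $(\log n)^{3/2}$. *)

(* Defs.v *)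
From HB Require Import structures.
From mathcomp Require Import all_boot all_order all_algebra.
From mathcomp Require Import all_classical all_reals all_analysis.
Import Order.TTheory GRing.Theory Num.Theory.
Import numFieldNormedType.Exports.

Set Implicit Arguments.
Unset Strict Implicit.
Unset Printing Implicit Defensive.

Local Open Scope classical_set_scope.
Local Open Scope ring_scope.

(* Mutual independence: the product rule over every subfamily J. *)
Definition independent_RVs (R : realType) (d : measure_display)
    (Omega : measurableType d) (P : probability Omega R) (m : nat)
    (g : 'I_m -> {RV P >-> R}) : Prop :=
  forall (J : {set 'I_m}) (A : 'I_m -> set R),
    (forall i, i \in J -> measurable (A i)) ->
    P (\bigcap_(i in [set` J]) (g i @^-1` A i)) =
    (\prod_(i in J) P (g i @^-1` A i))%E.

Definition standard_gaussian (R : realType) (d : measure_display)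
    (Omega : measurableType d) (P : probability Omega R)
    (X : {RV P >-> R}) : Prop :=
  forall A : set R, measurable A -> distribution P X A = normal_prob 0 1 A.

(* The expectation depends only on the joint law of the g i, so quantifying over
   all realizations on all probability spaces amounts to fixing one of them. *)
Definition gaussian_type2_bound (R : realType) (X : normedModType R) (M : R)
    : Prop :=
  forall (m : nat) (x : 'I_m -> X)
    (d : measure_display) (Omega : measurableType d) (P : probability Omega R)
    (g : 'I_m -> {RV P >-> R}),
    independent_RVs g -> (forall i, standard_gaussian (g i)) ->
    ('E_P[fun w => (`|\sum_(i < m) g i w *: x i|)%R] <=
      (M * Num.sqrt (\sum_(i < m) `|x i| ^+ 2))%R%:E)%E.

(* The initial value of the iterated minimum is the norm for the choice of all
   signs +1, so that this is the minimum over all 2 ^ m choices of signs. *)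
Definition min_signed_norm (R : realType) (X : normedModType R) (m : nat)
    (x : 'I_m -> X) : R :=
  \big[Num.min/`|\sum_(i < m) x i|]_(eta : {ffun 'I_m -> bool})
    `|\sum_(i < m) (-1) ^+ eta i *: x i|.

Definition infratype2_bound (R : realType) (X : normedModType R) (M : R)
    : Prop :=
  forall (m : nat) (x : 'I_m -> X),
    min_signed_norm x <= M * Num.sqrt (\sum_(i < m) `|x i| ^+ 2).

(* The best constants are extended reals, +oo when no finite constant works.
   The condition 0 <= M only matters when X is the zero space. *)
Definition T2 (R : realType) (X : normedModType R) : \bar R :=
  ereal_inf [set M%:E | M in [set M : R | 0 <= M /\ gaussian_type2_bound X M]].

Definition I2 (R : realType) (X : normedModType R) : \bar R :=
  ereal_inf [set M%:E | M in [set M : R | 0 <= M /\ infratype2_bound X M]].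

(* Main.v *)
From HB Require Import structures.
Require Import Defs.
From mathcomp Require Import all_boot all_order all_algebra.
From mathcomp Require Import all_classical all_reals all_analysis.
From mathcomp Require Import measurable_realfun.
From mathcomp Require Import ring lra zify.
Import Order.TTheory GRing.Theory Num.Theory.
Import numFieldNormedType.Exports.
Set Implicit Arguments.
Unset Strict Implicit.
Unset Printing Implicit Defensive.
Local Open Scope classical_set_scope.
Local Open Scope ring_scope.

(** Let M be an infratype 2 bound of X, let x_1, ..., x_m be vectors with
sum |x_i|^2 <= 1, and put G = sum_i g_i x_i. By finite-dimensional duality
([norming_functional]) the norm of G is the supremum of the Gaussian process
f |-> f(G) over the unit ball of the dual, whose metric is
d(f, f')^2 = sum_i (f x_i - f' x_i)^2. The theorem is Dudley's bound for this
process; the work lies in the entropy of the dual ball for d.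

- Infratype gives Maurey's lemma with the same exponent as type 2 ([maurey]):
  a sum of N unit vectors, counted with multiplicity, is twice a sum of at most
  N / 2 of them up to M * sqrt N, because the signs of the odd multiplicities
  can be balanced ([halve_multiset]). Iterating, each point of an absolutely
  convex hull of p vectors of the unit ball is within 4 M / sqrt K of an
  average of K of them, up to sign, so the hull is covered by (2p + 1)^K balls
  of that radius.

- Entropy is passed to the dual by one identity ([local_net]): with a_i =
  f x_i - f' x_i one has d(f, f')^2 = (f - f')(sum_i a_i x_i)
  <= 2 * |sum_i a_i x_i|. If d(f, f0) <= t, then sum_i (f x_i - f0 x_i) x_i
  lies in t times the absolutely convex hull of the normalized vectors
  x_i / |x_i|, by the Cauchy-Schwarz inequality. Hence a d-ball of radius t
  splits into (2p + 1)^K sets lying in d-balls of radius t / 2 as soon as K is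
  at least (64 M / t)^2, and the entropy at scale t is of order M^2 log p / t^2.

- Only d matters for the process, and d depends only on the tensor
  sum_i x_i (x) x_i, so the conic form of Caratheodory's theorem in dimension
  n^2 provides a family of p <= n^2 vectors with the same d and a sum of
  squared norms which is not larger ([reduce_covariance]).

Each dyadic scale then contributes at most a multiple of M * sqrt (log n) to the
chain ([chaining]). The chain stops at scale 1 / n, after about log n steps,
since the rest of the process is bounded by its Euclidean norm in the at most
n-dimensional space of the vectors (f x_i)_i ([gaussian_norm_dominated]). The
product is M * (log n)^(3/2). *)

(** * Norming functionals in finite dimension *)

Section Sublinear.
Context {R : realType} {V : lmodType R}.
Implicit Types (p q : V -> R) (x y e : V).

Definition sublinear p :=
  (forall x y, p (x + y) <= p x + p y) /\
  (forall a x, 0 <= a -> p (a *: x) = a * p x).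

Lemma sublinear0 p : sublinear p -> p 0 = 0.
Proof. by move=> [_ ph]; rewrite -(scale0r 0) ph// mul0r. Qed.

Lemma sublinear_oppr_ge p x : sublinear p -> - p (- x) <= p x.
Proof.
move=> sp; have [pD _] := sp.
by have := pD x (- x); rewrite subrr sublinear0//; lra.
Qed.

Definition tilt_values p e x : set R :=
  [set p (x + s *: e) - s * p e | s in [set s | 0 <= s]].

(** The largest sublinear functional below p that takes the value - p e at - e;
tilting along a basis makes a sublinear functional linear, which replaces the
one-dimensional extensions of the Hahn-Banach theorem. *)
Definition tilt p e x : R := inf (tilt_values p e x).

Lemma tilt_lbound p e x : sublinear p -> lbound (tilt_values p e x) (- p (- x)).
Proof.
move=> [pD ph] _ [s /= s0 <-].
have := pD (x + s *: e) (- x); rewrite addrAC subrr add0r ph//; lra.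
Qed.

Lemma tilt_le p e x s : sublinear p -> 0 <= s ->
  tilt p e x <= p (x + s *: e) - s * p e.
Proof.
move=> sp s0; apply: ge_inf; last by exists s.
by exists (- p (- x)); exact: tilt_lbound.
Qed.

Lemma tilt_values_neq0 p e x : tilt_values p e x !=set0.
Proof. by exists (p (x + 0 *: e) - 0 * p e), 0 => /=. Qed.

Lemma le_tilt p e x c : sublinear p ->
  (forall s, 0 <= s -> c <= p (x + s *: e) - s * p e) -> c <= tilt p e x.
Proof.
move=> sp H; apply: lb_le_inf; first exact: tilt_values_neq0.
by move=> _ [s /= s0 <-]; exact: H.
Qed.

Lemma tilt_le_self p e x : sublinear p -> tilt p e x <= p x.
Proof.
by move=> sp; have := tilt_le e x sp (lexx 0); rewrite scale0r addr0 mul0r subr0.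
Qed.

Lemma tiltN p e : sublinear p -> tilt p e (- e) <= - p e.
Proof.
move=> sp; have := tilt_le e (- e) sp ler01.
by rewrite scale1r addNr sublinear0// mul1r sub0r.
Qed.

Lemma tilt_sublinear p e : sublinear p -> sublinear (tilt p e).
Proof.
move=> sp; have [pD ph] := sp; split=> [x y|a x].
  rewrite -lerBlDr; apply: le_tilt => // s s0.
  rewrite lerBlDr -lerBlDl; apply: le_tilt => // t t0.
  have := tilt_le e (x + y) sp (addr_ge0 s0 t0).
  have := pD (x + s *: e) (y + t *: e).
  rewrite addrACA -scalerDl; lra.
rewrite le_eqVlt => /predU1P[<-|a0].
  rewrite scale0r mul0r; apply/le_anti/andP; split.
    by rewrite -(sublinear0 sp); exact: tilt_le_self.
  apply: le_tilt => // s s0; rewrite add0r ph//; lra.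
apply/le_anti/andP; split.
  rewrite -ler_pdivrMl//; apply: le_tilt => // s s0.
  rewrite ler_pdivrMl// mulrBr -(ph a) ?(ltW a0)// scalerDr scalerA mulrA.
  by apply: tilt_le => //; rewrite mulr_ge0// ltW.
apply: le_tilt => // s s0.
have -> : a *: x + s *: e = a *: (x + (a^-1 * s) *: e).
  by rewrite scalerDr scalerA mulrA mulfV ?mul1r// gt_eqF.
have -> : s * p e = a * (a^-1 * s * p e) by field; rewrite gt_eqF.
rewrite ph ?(ltW a0)// -mulrBr ler_pM2l//; apply: tilt_le => //.
by rewrite mulr_ge0// invr_ge0 ltW.
Qed.

(** Sublinear minorants keep the directions in which p is already linear, so
tilting in a new direction does not spoil the earlier ones. *)
Lemma sublinear_dominated_odd p q x : sublinear p -> sublinear q ->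
  (forall y, q y <= p y) -> p (- x) = - p x -> q (- x) = - q x.
Proof.
move=> sp sq qp px.
have := sublinear_oppr_ge x sq; have := qp x; have := qp (- x); rewrite px.
lra.
Qed.

Lemma tilt_odd p e : sublinear p -> tilt p e (- e) = - tilt p e e.
Proof.
move=> sp; have := tiltN e sp; have := tilt_le_self e e sp.
have := sublinear_oppr_ge e (tilt_sublinear e sp); lra.
Qed.

(** Tilt along the vectors of s, one after the other. *)
Lemma odd_minorant p (s : seq V) : sublinear p ->
  exists q, [/\ sublinear q, forall x, q x <= p x &
    {in s, forall e, q (- e) = - q e}].
Proof.
elim: s p => [|e s IHs] p sp; first by exists p.
have [q [sq qp qs]] := IHs _ (tilt_sublinear e sp).
exists q; split=> //.
  by move=> x; apply: le_trans (qp x) (tilt_le_self _ _ sp).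
move=> x; rewrite inE => /predU1P[->|]; last exact: qs.
exact: (sublinear_dominated_odd (tilt_sublinear e sp) sq qp (tilt_odd e sp)).
Qed.

Lemma odd_additive q x y : sublinear q -> q (- y) = - q y ->
  q (x + y) = q x + q y.
Proof.
move=> [qD _] qy; apply/le_anti; rewrite qD/=.
by have := qD (x + y) (- y); rewrite addrK qy; lra.
Qed.

Lemma odd_scale q x a : sublinear q -> q (- x) = - q x ->
  q (a *: x) = a * q x.
Proof.
move=> [_ qh] qx; have [a0|a0] := leP 0 a; first exact: qh.
have a0' : 0 <= - a by lra.
by rewrite -[a]opprK scaleNr -scalerN qh// qx; ring.
Qed.

Lemma odd_lin_comb q n (c : 'I_n -> R) (e : 'I_n -> V) : sublinear q ->
  (forall i, q (- e i) = - q (e i)) ->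
  q (- \sum_i c i *: e i) = - q (\sum_i c i *: e i).
Proof.
move=> sq qe; elim/big_ind : _ => [|x y qx qy|i _].
- by rewrite oppr0 sublinear0// oppr0.
- by rewrite opprD !odd_additive// ?opprK ?qx ?qy ?opprK// opprD.
- by rewrite -scaleNr !odd_scale// mulNr.
Qed.

End Sublinear.

Definition in_dual_ball {R : realType} {X : normedModType R}
  (f : {linear X -> R^o}) := forall x, f x <= `|x|.

Lemma coordinates {R : realType} {X : lmodType R} n : Vector.axiom n X ->
  exists (c : X -> 'I_n -> R) (e : 'I_n -> X),
    forall z, z = \sum_k c z k *: e k.
Proof.
move=> [v2r lin_v2r [r2v v2rK r2vK]].
pose v2rl := GRing.isLinear.Build _ _ _ _ v2r lin_v2r.
pose v2r' : {linear X -> 'rV[R]_n} := HB.pack v2r v2rl.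
exists (fun z => v2r z 0), (fun k => r2v (delta_mx 0 k)) => z.
apply: (can_inj v2rK); rewrite -[RHS]/(v2r' _) linear_sum [LHS]row_sum_delta.
by apply: eq_bigr => k _; rewrite linearZ/= r2vK.
Qed.

Section DualBall.
Context {R : realType} {X : normedModType R}.

Lemma dualZ (f : {linear X -> R^o}) (c : R) v : f (c *: v) = c * f v.
Proof. by rewrite linearZ. Qed.

Lemma dual_sum (J : Type) (s : seq J) (f : {linear X -> R^o}) (c : J -> R)
    (v : J -> X) :
  f (\sum_(i <- s) c i *: v i) = \sum_(i <- s) c i * f (v i).
Proof. by rewrite linear_sum; apply: eq_bigr => i _; rewrite dualZ. Qed.

Lemma dual_coordinates n : Vector.axiom n X ->
  exists (c : X -> 'I_n -> R) (e : 'I_n -> X),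
    forall (f : {linear X -> R^o}) z, f z = \sum_k c z k * f (e k).
Proof.
move=> /coordinates[c [e zE]]; exists c, e => f z.
by rewrite {1}(zE z) dual_sum.
Qed.

(** The norm is tilted along x0, which forces the value at - x0 to be - |x0|,
and then along a basis, which makes it linear. *)
Lemma norming_functional n (x0 : X) : Vector.axiom n X ->
  exists2 f : {linear X -> R^o}, in_dual_ball f & f x0 = `|x0|.
Proof.
move=> /coordinates[c [e zE]].
have snorm : sublinear (fun x : X => `|x|).
  by split=> [x y|a x a0]; [exact: ler_normD|rewrite normrZ ger0_norm].
pose p := tilt (fun x : X => `|x|) x0.
have sp : sublinear p by exact: tilt_sublinear.
have [q [sq qp qe]] := odd_minorant (codom e) sp.
have qN x : q (- x) = - q x.
  rewrite (zE x); apply: odd_lin_comb => // i; apply: qe; exact: codom_f.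
have qlin : linear (q : X -> R^o).
  by move=> a x y; rewrite odd_additive// odd_scale.
pose ql := GRing.isLinear.Build _ _ _ _ (q : X -> R^o) qlin.
pose f : {linear X -> R^o} := HB.pack (q : X -> R^o) ql.
exists f => [x|] /=.
  by apply: le_trans (qp x) _; exact: tilt_le_self.
apply/le_anti/andP; split.
  by apply: le_trans (qp x0) _; exact: tilt_le_self.
have := qp (- x0); have := tiltN x0 snorm; rewrite -/p /= qN; lra.
Qed.
End DualBall.

(** * Conic Caratheodory theorem and orthonormalization *)

Section Caratheodory.
Context {R : realType} {m d : nat}.
Variable z : 'I_m -> 'rV[R]_d.

Lemma linear_dependency (S : {set 'I_m}) : (d < #|S|)%N ->
  exists l : 'I_m -> R, [/\ exists i, l i != 0,
    forall i, i \notin S -> l i = 0 & \sum_i l i *: z i = 0].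
Proof.
move=> dS; pose B := \matrix_(k < #|S|) z (enum_val k).
have : kermx B != 0.
  rewrite -mxrank_eq0 mxrank_ker subn_eq0 -ltnNge.
  exact: leq_ltn_trans (rank_leq_col B) dS.
case/rowV0Pn => v /sub_kermxP vB v0.
pose l i := \sum_(k < #|S|) v 0 k * (enum_val k == i)%:R.
have lE k : l (enum_val k) = v 0 k.
  rewrite /l (bigD1 k)//= eqxx mulr1 big1 ?addr0// => k' k'k.
  by rewrite (inj_eq enum_val_inj) (negbTE k'k) mulr0.
have l0 i : i \notin S -> l i = 0.
  move=> iS; apply: big1 => k _; case: eqP => [E|]; last by rewrite mulr0.
  by move: iS; rewrite -E enum_valP.
exists l; split=> //.
  by have /rV0Pn[k vk] := v0; exists (enum_val k); rewrite lE.
have -> : \sum_i l i *: z i = \sum_(i in S) l i *: z i.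
  rewrite [RHS]big_mkcond; apply: eq_bigr => i _.
  by case: ifPn => // iS; rewrite l0// scale0r.
rewrite big_enum_val/= -[RHS]vB mulmx_sum_row.
apply: eq_bigr => k _.
by rewrite lE rowK.
Qed.

Lemma signed_linear_dependency (S : {set 'I_m}) (c : 'I_m -> R) :
  (forall i, 0 <= c i) -> (d < #|S|)%N ->
  exists l : 'I_m -> R, [/\ exists i, 0 < l i,
    forall i, i \notin S -> l i = 0, \sum_i l i *: z i = 0 &
    0 <= \sum_i l i * c i].
Proof.
move=> c0 /linear_dependency[l [[i li] lS lz]].
have opp : [/\ forall i, i \notin S -> - l i = 0, \sum_i - l i *: z i = 0 &
    \sum_i - l i * c i = - \sum_i l i * c i].
  split=> [j /lS ->||]; first by rewrite oppr0.
    by under eq_bigr do rewrite scaleNr; rewrite sumrN lz oppr0.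
  by under eq_bigr do rewrite mulNr; rewrite sumrN.
have pos (k : 'I_m -> R) : 0 < \sum_i k i * c i -> exists i, 0 < k i.
  move=> H; apply/not_existsP => kN; move: H; apply/negP; rewrite -leNgt.
  apply: sumr_le0 => j _; rewrite mulr_le0_ge0// leNgt; apply/negP; exact: kN.
case: opp => opp1 opp2 opp3.
have [H|H|H] := ltgtP 0 (\sum_i l i * c i).
- by exists l; split=> //; [exact: pos|exact: ltW].
- exists (fun i => - l i); split=> //; first by apply: pos; rewrite opp3; lra.
  by rewrite opp3; lra.
- have [li0|li0|li0] := ltgtP 0 (l i); last by rewrite -li0 eqxx in li.
    by exists l; split=> //; [exists i|rewrite -H].
  exists (fun i => - l i); split=> //; first by exists i; lra.
  by rewrite opp3 -H oppr0.
Qed.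

(** While more than d weights are nonzero, a dependency between the vectors that
carry them is subtracted until one weight vanishes; the dependency has
nonnegative total cost, so the cost does not grow. *)
Lemma conic_caratheodory (c w : 'I_m -> R) :
  (forall i, 0 <= c i) -> (forall i, 0 <= w i) ->
  exists w' : 'I_m -> R, [/\ forall i, 0 <= w' i,
    (#|finset (fun i => w' i != 0%R)| <= d)%N, \sum_i w' i *: z i = \sum_i w i *: z i &
    \sum_i w' i * c i <= \sum_i w i * c i].
Proof.
move=> c0; move: {2}_.+1 (ltnSn #|finset (fun i => w i != 0%R)|) => N.
elim: N w => [//|N IHN] w; rewrite ltnS => wN w0.
have [?|dS] := leqP #|finset (fun i => w i != 0%R)| d; first by exists w.
have [l [[i0 li0] lS lz lc]] := signed_linear_dependency c0 dS.
case: (@Order.TotalTheory.arg_minP _ _ _ i0 (fun i => 0 < l i)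
  (fun i => w i / l i) li0) => i li imin.
pose t := w i / l i.
have t0 : 0 <= t by rewrite divr_ge0// ltW.
pose w1 j := w j - t * l j.
have w10 j : 0 <= w1 j.
  rewrite subr_ge0; have [lj|lj] := ltP 0 (l j).
    by rewrite -ler_pdivlMr//; exact: imin.
  by rewrite (le_trans _ (w0 j))// mulr_ge0_le0.
have w1i : w1 i = 0 by rewrite /w1 /t divfK ?subrr// gt_eqF.
have w1N : (#|finset (fun j => w1 j != 0%R)| < N)%N.
  apply: leq_trans wN; apply: proper_card; apply/properP; split.
    apply/fintype.subsetP => j; rewrite !inE; apply: contra_neq => wj.
    by rewrite /w1 lS ?inE ?wj ?eqxx// mulr0 subr0.
  exists i; rewrite !inE ?w1i ?eqxx//.
  by apply/eqP => wi; move: li; rewrite lS ?ltxx// inE wi eqxx.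
have [w' [w'0 w'd w'z w'c]] := IHN _ w1N w10.
exists w'; split=> //.
  rewrite w'z /w1; under eq_bigr do rewrite scalerBl -scalerA.
  by rewrite big_split/= sumrN -scaler_sumr lz scaler0 subr0.
apply: le_trans w'c _; rewrite /w1; under eq_bigr do rewrite mulrBl -mulrA.
by rewrite big_split/= sumrN -mulr_sumr gerBl mulr_ge0.
Qed.

End Caratheodory.

Section GramSchmidt.
Context {R : realType}.

Lemma dot_rV_norm m (u : 'rV[R]_m) : 0 <= (u *m u^T) 0 0.
Proof.
by rewrite mxE sumr_ge0// => i _; rewrite mxE -expr2 sqr_ge0.
Qed.

Lemma dot_rV_eq0 m (u : 'rV[R]_m) : (u *m u^T) 0 0 = 0 -> u = 0.
Proof.
rewrite mxE => /eqP; rewrite psumr_eq0.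
  move=> /allP u0; apply/rowP => i; have := u0 i (mem_index_enum _).
  by rewrite /= !mxE mulf_eq0 orbb => /eqP.
by move=> i _; rewrite mxE -expr2 sqr_ge0.
Qed.

(** The rows of Q are an orthonormal basis of a space that contains the rows of
A: the last equation says that projecting onto it fixes them. *)
Lemma gram_schmidt n m (A : 'M[R]_(n, m)) :
  exists r (Q : 'M[R]_(r, m)), [/\ (r <= n)%N, Q *m Q^T = 1%:M &
    A *m Q^T *m Q = A].
Proof.
elim: n A => [|n IHn] A.
  by exists 0, 0; split=> //; [apply/matrixP => -[]|apply/matrixP => -[]].
rewrite -[n.+1]/(1 + n)%N in A *.
rewrite -(vsubmxK A); set a := usubmx A; set B := dsubmx A.
have [r [Q [rn QQ BQ]]] := IHn B.
pose b := a - a *m Q^T *m Q.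
have bQ : b *m Q^T = 0 by rewrite mulmxBl -!mulmxA QQ mulmx1 subrr.
have ab : a = b + a *m Q^T *m Q by rewrite subrK.
have [b0|b0] := eqVneq b 0.
  exists r, Q; split=> //; first exact: leqW.
  by rewrite !mul_col_mx BQ [in RHS]ab b0 add0r.
pose s := Num.sqrt ((b *m b^T) 0 0).
have s0 : s != 0.
  rewrite sqrtr_eq0 -ltNge lt_neqAle dot_rV_norm andbT eq_sym.
  by apply: contra_neq b0; exact: dot_rV_eq0.
have bb : b *m b^T = (s ^+ 2)%:M.
  by rewrite [LHS]mx11_scalar sqr_sqrtr// dot_rV_norm.
pose e := s^-1 *: b.
have ee : e *m e^T = 1%:M.
  rewrite /e linearZ/= -scalemxAl -scalemxAr bb scalerA scale_scalar_mx.
  by congr (_ %:M); field.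
have eQ : e *m Q^T = 0 by rewrite -scalemxAl bQ scaler0.
have Qe : Q *m e^T = 0 by rewrite -[Q]trmxK -trmx_mul eQ trmx0.
exists (1 + r)%N, (col_mx e Q); split.
- by rewrite add1n ltnS.
- rewrite tr_col_mx mul_col_row ee eQ Qe QQ.
  by rewrite -scalar_mx_block.
- rewrite tr_col_mx mul_col_mx -[RHS](vsubmxK _) !col_mxKu !col_mxKd.
  rewrite !mul_col_mx !mul_mx_row !mul_row_col BQ.
  have -> : B *m e^T = 0.
    by rewrite -BQ -mulmxA Qe mulmx0.
  rewrite mul0mx add0r; congr col_mx.
  have -> : a *m e^T = s%:M.
    rewrite {1}ab mulmxDl -[X in _ + X]mulmxA Qe mulmx0 addr0.
    rewrite /e linearZ/= -scalemxAr bb scale_scalar_mx.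
    by congr (_ %:M); field.
  by rewrite mul_scalar_mx /e scalerA mulfV// scale1r -ab.
Qed.

End GramSchmidt.

(** * Gaussian sums *)

Section DensityImage.
Context {R : realType} d d' (T : measurableType d) (Y : measurableType d').
Variables (mu : {measure set T -> \bar R}) (nu : {measure set Y -> \bar R}).
Variables (g : T -> R) (X : T -> Y).
Hypotheses (g0 : forall x, 0 <= g x) (mg : measurable_fun setT g).
Hypothesis mX : measurable_fun setT X.
Hypothesis gX : forall A, measurable A ->
  (\int[mu]_x (g x * \1_A (X x))%:E = nu A)%E.

Import HBNNSimple.

Lemma integral_density_image_nnsfun (h : {nnsfun Y >-> R}) :
  (\int[mu]_x (g x * h (X x))%:E = \int[nu]_y (h y)%:E)%E.
Proof.
have mh r : measurable (h @^-1` [set r]) by [].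
transitivity (\int[nu]_y (\sum_(r \in range h)
    (r * \1_(h @^-1` [set r]) y)%:E))%E; last first.
  by apply: eq_integral => y _; rewrite /= fimfunE -fsumEFin.
rewrite ge0_integral_fsum//; last 2 first.
- by move=> r; apply/measurable_EFinP; exact: measurable_funM.
- by move=> r y _; exact: nnfun_muleindic_ge0.
have m1 r : measurable_fun setT (fun x => \1_(h @^-1` [set r]) (X x) : R).
  have mi : measurable_fun setT (\1_(h @^-1` [set r]) : Y -> R).
    exact: measurable_indic.
  exact: (measurableT_comp mi mX).
have mgX r : measurable_fun setT (fun x => (g x * \1_(h @^-1` [set r]) (X x))%:E).
  by apply/measurable_EFinP; exact: measurable_funM.
transitivity (\int[mu]_x (\sum_(r \in range h)
    (r%:E * (g x * \1_(h @^-1` [set r]) (X x))%:E)))%E.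
  apply: eq_integral => x _; rewrite fimfunE.
  rewrite EFinM -fsumEFin// ge0_mule_fsumr; last first.
    by move=> r; exact: nnfun_muleindic_ge0.
  by apply: eq_fsbigr => r _; rewrite -!EFinM mulrCA.
rewrite ge0_integral_fsum//; last 2 first.
- by move=> r; exact: measurable_funeM.
- move=> r x _; rewrite -EFinM mulrCA EFinM mule_ge0 ?lee_fin//.
  exact: nnfun_muleindic_ge0.
apply: eq_fsbigr => r; rewrite inE => -[t _ <-].
rewrite ge0_integralZl// ?lee_fin//; last first.
  by move=> x _; rewrite lee_fin mulr_ge0// indicE.
under [RHS]eq_integral do rewrite EFinM.
rewrite ge0_integralZl ?lee_fin//; last exact/measurable_EFinP.
by rewrite gX// integral_indic// setIT.
Qed.

(** Change of variables for the image under X of the measure with density g: it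
serves both for independence (g is a product of the other factors) and for the
normal law (X is the identity). *)
Lemma integral_density_image (f : Y -> R) : (forall y, 0 <= f y) ->
  measurable_fun setT f ->
  (\int[mu]_x (g x * f (X x))%:E = \int[nu]_y (f y)%:E)%E.
Proof.
move=> f0 mf; have mfE : measurable_fun setT (EFin \o f) by exact/measurable_EFinP.
pose h := nnsfun_approx measurableT mfE.
have hf y : (EFin \o h n) y @[n --> \oo] --> (f y)%:E.
  by apply: (cvg_nnsfun_approx measurableT mfE) => // x _; rewrite /= lee_fin.
have hnd y : {homo (fun n => h n y) : n m / (n <= m)%N >-> n <= m}.
  by move=> a b ab; exact/lefP/nd_nnsfun_approx.
transitivity (limn (fun n => \int[mu]_x (g x * h n (X x))%:E)%E); last first.
  under eq_fun do rewrite integral_density_image_nnsfun.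
  apply/esym.
  under eq_integral => y _ do rewrite -(cvg_lim _ (hf y))//.
  apply: monotone_convergence => //.
  - by move=> n; apply/measurable_EFinP.
  - by move=> n x _ /=; rewrite lee_fin.
  - by move=> x _ a b ab; rewrite lee_fin; exact: hnd.
have hg x : (g x * h n (X x))%:E @[n --> \oo] --> (g x * f (X x))%:E.
  under eq_fun do rewrite EFinM.
  by rewrite EFinM; apply: cvgeZl => //; exact: hf.
under eq_integral => y _ do rewrite -(cvg_lim _ (hg y))//.
apply: monotone_convergence => //.
- move=> n; apply/measurable_EFinP; apply: measurable_funM => //.
  exact: measurableT_comp.
- by move=> n x _; rewrite lee_fin mulr_ge0.
- by move=> x _ a b ab; rewrite lee_fin ler_wpM2l// hnd.
Qed.

End DensityImage.

Section Gaussian.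
Context {R : realType}.

(** Completing the square turns exp (c x) times the standard normal density into
exp (c^2 / 2) times the density centred at c. *)
Lemma integral_normal_expR (nu : {measure set R -> \bar R}) (c : R) :
  (forall A, measurable A -> nu A = normal_prob 0 1 A) ->
  (\int[nu]_x (expR (c * x))%:E = (expR (c ^+ 2 / 2))%:E)%E.
Proof.
move=> nuE.
rewrite -(integral_density_image (mu := lebesgue_measure) (nu := nu)
  (g := normal_pdf 0 1) (X := idfun)); last 6 first.
- exact: normal_pdf_ge0.
- exact: measurable_normal_pdf.
- exact: measurable_id.
- move=> A mA; rewrite nuE// /normal_prob.
  rewrite [RHS]integral_mkcond; apply: eq_integral => x _ /=.
  by rewrite patchE indicE; case: ifPn; rewrite ?mulr1 ?mulr0.
- by move=> y; exact: expR_ge0.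
- apply: measurableT_comp => //; exact: measurable_funM.
transitivity (\int[lebesgue_measure]_x
    ((expR (c ^+ 2 / 2))%:E * (normal_pdf c 1 x)%:E))%E.
  apply: eq_integral => x _; rewrite -EFinM; congr EFin.
  rewrite !normal_pdfE ?oner_neq0// /normal_fun mulrAC mulrCA -mulrA.
  by rewrite -!expRD; congr (_ * expR _) => /=; field.
rewrite ge0_integralZl//.
- by rewrite integral_normal_pdf mule1.
- by apply/measurable_EFinP; exact: measurable_normal_pdf.
- by move=> x _; rewrite lee_fin normal_pdf_ge0.
Qed.

Context d (T : measurableType d) (P : probability T R).

Lemma standard_gaussian_mgf (X : {RV P >-> R}) (c : R) : standard_gaussian X ->
  (\int[P]_w (expR (c * X w))%:E = (expR (c ^+ 2 / 2))%:E)%E.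
Proof.
move=> gX.
rewrite -(integral_normal_expR (nu := distribution P X))//.
rewrite ge0_integral_distribution//.
by apply/measurable_EFinP; apply: measurableT_comp.
Qed.

Context {m : nat} (g : 'I_m -> {RV P >-> R}).
Hypothesis ind : independent_RVs g.

(** The product rule for events is the case of indicators; the indicators are
replaced one at a time by arbitrary functions. *)
Lemma independent_integral_prod (F : 'I_m -> R -> R) :
  (forall i x, 0 <= F i x) -> (forall i, measurable_fun setT (F i)) ->
  (forall i, (\int[P]_w (F i (g i w))%:E)%E \is a fin_num) ->
  (\int[P]_w (\prod_i F i (g i w))%:E =
   \prod_i \int[P]_w (F i (g i w))%:E)%E.
Proof.
(* the first k factors are arbitrary, the other ones are indicators *)
suff main k : (k <= m)%N -> forall F : 'I_m -> R -> R,
    (forall i x, 0 <= F i x) -> (forall i, measurable_fun setT (F i)) ->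
    (forall i, (\int[P]_w (F i (g i w))%:E)%E \is a fin_num) ->
    (forall i : 'I_m, (k <= i)%N -> exists2 A, measurable A & F i = \1_A) ->
    (\int[P]_w (\prod_i F i (g i w))%:E =
     \prod_i \int[P]_w (F i (g i w))%:E)%E.
  move=> F0 mF fF; apply: (main m) => // i; by rewrite leqNgt ltn_ord.
elim: k => [_|k IHk km] {}F F0 mF fF FA.
  have /choice[A AP] : forall i, exists A, measurable A /\ F i = \1_A.
    by move=> i; have [A mA FiA] := FA i (leq0n _); exists A.
  have FE i w : F i (g i w) = \1_(g i @^-1` A i) w by rewrite (AP i).2.
  transitivity (P (\bigcap_(i in [set` [set: 'I_m]%SET]) (g i @^-1` A i))).
    rewrite -[X in P X]setIT -integral_indic//; last first.
      apply: fin_bigcap_measurable => // i _.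
      by apply: measurable_funPTI => //; exact: (AP i).1.
    apply: eq_integral => w _; congr EFin.
    under eq_bigr do rewrite FE indicE.
    rewrite indicE; case: (boolP (w \in _)) => [|/negP wN].
      rewrite inE => wA; rewrite big1// => i _.
      by rewrite mem_set//; apply: wA; rewrite /= inE.
    apply/eqP/prodf_eq0.
    suff [i iN] : exists i, ~ (g i @^-1` A i) w.
      by exists i => //; rewrite memNset.
    apply/existsNP => wA; apply: wN; rewrite inE => i _; exact: wA.
  rewrite ind; last by move=> i _; exact: (AP i).1.
  rewrite big_mkcond; apply: eq_bigr => i _; rewrite inE/=.
  under eq_integral do rewrite FE.
  rewrite integral_indic// ?setIT//.
  by apply: measurable_funPTI => //; exact: (AP i).1.
pose i0 := Ordinal km.
pose W w := \prod_(i | i != i0) F i (g i w).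
have W0 w : 0 <= W w by exact: prodr_ge0.
have mFg i : measurable_fun setT (fun w => F i (g i w)).
  exact: measurableT_comp.
have mW : measurable_fun setT W.
  rewrite /W; under eq_fun do rewrite big_mkcond/=.
  by apply: measurable_prod => i _; case: (i != i0).
pose C : \bar R := (\prod_(i | i != i0) \int[P]_w (F i (g i w))%:E)%E.
have Cfin : C \is a fin_num.
  exact: prode_fin_num.
have C0 : (0 <= C)%E.
  apply: prode_ge0 => i _; apply: integral_ge0 => w _; by rewrite lee_fin.
have WA A : measurable A ->
    (\int[P]_w (W w * \1_A (g i0 w))%:E = C * P (g i0 @^-1` A))%E.
  move=> mA; pose F' i := if i == i0 then \1_A else F i.
  have mgA : measurable (g i0 @^-1` A) by exact: measurable_funPTI.
  have I0 : (\int[P]_w (F' i0 (g i0 w))%:E = P (g i0 @^-1` A))%E.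
    transitivity (\int[P]_w (\1_(g i0 @^-1` A) w)%:E)%E.
      by apply: eq_integral => w _; rewrite /F' eqxx.
    by rewrite integral_indic// setIT.
  have PE : (\prod_i \int[P]_w (F' i (g i w))%:E = P (g i0 @^-1` A) * C)%E.
    rewrite (bigD1 i0)//= I0; congr (_ * _)%E.
    by apply: eq_bigr => i /negbTE ii0; rewrite /F' ii0.
  rewrite muleC -PE -(IHk (ltnW km)).
  - apply: eq_integral => w _; congr EFin.
    rewrite [RHS](bigD1 i0)//= /F' eqxx mulrC; congr (_ * _).
    by apply: eq_bigr => i /negbTE ->.
  - by move=> i x; rewrite /F'; case: ifP => // _; rewrite indicE.
  - by move=> i; rewrite /F'; case: ifP => // _; exact: measurable_indic.
  - move=> i; have [->|ii0] := eqVneq i i0.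
      by rewrite I0 fin_num_measure.
    by rewrite /F' (negbTE ii0).
  - move=> i ki; rewrite /F'; case: eqP => [_|/eqP ii0]; first by exists A.
    apply: FA; rewrite ltn_neqAle ki andbT; apply: contra ii0 => /eqP kE.
    exact/eqP/val_inj.
have C0' : 0 <= fine C by rewrite fine_ge0.
rewrite [RHS](bigD1 i0)//= -/C.
transitivity (\int[P]_w (W w * F i0 (g i0 w))%:E)%E.
  by apply: eq_integral => w _; rewrite (bigD1 i0)//= mulrC.
rewrite (integral_density_image (nu := mscale (NngNum C0') (distribution P (g i0)))
  (g := W) (X := g i0))//; last first.
  by move=> A mA; rewrite WA// -[in LHS](fineK Cfin).
have mF0 : measurable_fun setT (fun y => (F i0 y)%:E) by exact/measurable_EFinP.
rewrite ge0_integral_mscale//=; last by move=> y _; rewrite lee_fin.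
rewrite ge0_integral_distribution//; last by move=> y; rewrite lee_fin.
by rewrite -[in RHS](fineK Cfin) muleC.
Qed.

Hypothesis gauss : forall i, standard_gaussian (g i).

Lemma gaussian_sum_mgf (v : 'I_m -> R) :
  (\int[P]_w (expR (\sum_i v i * g i w))%:E =
   (expR ((\sum_i v i ^+ 2) / 2))%:E)%E.
Proof.
under eq_integral do rewrite expR_sum.
rewrite (independent_integral_prod (F := fun i x => expR (v i * x))).
- under eq_bigr do rewrite standard_gaussian_mgf//.
  by rewrite mulr_suml expR_sum prodEFin.
- by move=> i x; exact: expR_ge0.
- by move=> i; apply: measurableT_comp => //; exact: measurable_funM.
- by move=> i; rewrite standard_gaussian_mgf.
Qed.

Lemma measurable_gaussian_sum (v : 'I_m -> R) :
  measurable_fun setT (fun w => \sum_i v i * g i w).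
Proof.
by apply: measurable_sum => i; apply: measurable_funM.
Qed.

End Gaussian.

Section GaussianMaxima.
Context {R : realType} d (T : measurableType d) (P : probability T R).
Context {m : nat} (g : 'I_m -> {RV P >-> R}).
Hypothesis ind : independent_RVs g.
Hypothesis gauss : forall i, standard_gaussian (g i).

(** From y <= exp y one gets S <= A + exp (l (S - A)) / l, and the sum of the
right-hand sides over J dominates every S. With l = A / t^2 the expectation of
the exponential terms is at most t^2 / A, since J has at most
exp (A^2 / (2 t^2)) elements. *)
Lemma gaussian_max_dominated (J : finType) (v : J -> 'I_m -> R) (t A : R) :
  0 < t -> 0 < A -> (forall j, \sum_i v j i ^+ 2 <= t ^+ 2) ->
  #|J|%:R <= expR (A ^+ 2 / (2 * t ^+ 2)) ->
  exists Psi : T -> R, [/\ measurable_fun setT Psi, forall w, 0 <= Psi w,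
    forall j w, \sum_i v j i * g i w <= Psi w &
    (\int[P]_w (Psi w)%:E <= (A + t ^+ 2 / A)%:E)%E].
Proof.
move=> t0 A0 vt JA; pose l := A / t ^+ 2.
have l0 : 0 < l by rewrite divr_gt0// exprn_gt0.
pose c := l^-1 * expR (- (l * A)).
have c0 : 0 <= c by rewrite mulr_ge0 ?expR_ge0// invr_ge0 ltW.
pose E j w := expR (\sum_i (l * v j i) * g i w).
have mE j : measurable_fun setT (E j).
  by apply: measurableT_comp => //; exact: measurable_gaussian_sum.
have mS : measurable_fun setT (fun w => c * \sum_j E j w).
  by apply: measurable_funM => //; exact: measurable_sum.
exists (fun w => A + c * \sum_j E j w); split.
- exact: measurable_funD.
- move=> w; rewrite addr_ge0 ?(ltW A0)// mulr_ge0//.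
  by apply: sumr_ge0 => j _; exact: expR_ge0.
- move=> j w; set S := \sum_i _.
  have ES : E j w = expR (l * S).
    by rewrite /E /S mulr_sumr; congr expR; apply: eq_bigr => i _; rewrite mulrA.
  have H1 : l * (S - A) <= expR (l * (S - A)).
    by have := expR_ge1Dx (l * (S - A)); lra.
  have H2 : S - A <= c * E j w.
    rewrite /c ES -mulrA -expRD mulrC ler_pdivlMr// mulrC (le_trans H1)//.
    by rewrite le_eqVlt; apply/orP; left; apply/eqP; congr expR; ring.
  have H3 : c * E j w <= c * \sum_j E j w.
    rewrite ler_wpM2l// (bigD1 j)//= lerDl.
    by apply: sumr_ge0 => i _; exact: expR_ge0.
  lra.
- under eq_integral do rewrite EFinD.
  rewrite ge0_integralD//=; last 3 first.
  + by move=> w _; rewrite lee_fin ltW.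
  + move=> w _; rewrite lee_fin mulr_ge0//.
    by apply: sumr_ge0 => j _; exact: expR_ge0.
  + exact/measurable_EFinP.
  rewrite integral_cst// [X in (_ * X)%E](_ : _ = 1%E); last exact: probability_setT.
  rewrite mule1 EFinD leeD2l//.
  under eq_integral do rewrite EFinM.
  rewrite ge0_integralZl//=; last 2 first.
  + by apply/measurable_EFinP; exact: measurable_sum.
  + by move=> w _; rewrite lee_fin; apply: sumr_ge0 => j _; exact: expR_ge0.
  under eq_integral do rewrite -sumEFin.
  rewrite ge0_integral_sum//=; last 2 first.
  + by move=> j; apply/measurable_EFinP.
  + by move=> j w _; rewrite lee_fin expR_ge0.
  under eq_bigr do rewrite (gaussian_sum_mgf ind gauss).
  rewrite sumEFin -EFinM lee_fin.
  have H j : expR ((\sum_i (l * v j i) ^+ 2) / 2) <= expR (A ^+ 2 / (2 * t ^+ 2)).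
    rewrite ler_expR; under eq_bigr do rewrite exprMn.
    rewrite -mulr_sumr.
    have -> : A ^+ 2 / (2 * t ^+ 2) = l ^+ 2 * t ^+ 2 / 2.
      by rewrite /l; field; rewrite gt_eqF.
    by rewrite ler_pM2r// ler_wpM2l// ?sqr_ge0.
  have HJ : \sum_j expR ((\sum_i (l * v j i) ^+ 2) / 2) <=
      expR (A ^+ 2 / (2 * t ^+ 2)) * expR (A ^+ 2 / (2 * t ^+ 2)).
    apply: le_trans (ler_sum _ (fun j _ => H j)) _.
    by rewrite sumr_const -[leLHS]mulr_natl; apply: ler_wpM2r; rewrite ?expR_ge0.
  apply: le_trans (ler_wpM2l c0 HJ) _.
  rewrite /c -mulrA -!expRD.
  have -> : l^-1 = t ^+ 2 / A by rewrite /l invf_div.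
  have -> : - (l * A) + (A ^+ 2 / (2 * t ^+ 2) + A ^+ 2 / (2 * t ^+ 2)) = 0.
    by rewrite /l; field; rewrite gt_eqF.
  by rewrite expR0 mulr1.
Qed.

Lemma expR_half_le2 : expR (2^-1 : R) <= 2.
Proof.
have := expR_ge1Dx (- 2^-1 : R); rewrite expRN => H.
by rewrite -lef_pV2 ?posrE ?expR_gt0//; lra.
Qed.

(** |S| <= exp S + exp (- S), and each exponential has expectation
exp (1 / 2) <= 2. *)
Lemma gaussian_abs_dominated (r : nat) (v : 'I_r -> 'I_m -> R) :
  (forall j, \sum_i v j i ^+ 2 = 1) ->
  exists Psi : T -> R, [/\ measurable_fun setT Psi, forall w, 0 <= Psi w,
    forall w, \sum_j `|\sum_i v j i * g i w| <= Psi w &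
    (\int[P]_w (Psi w)%:E <= (4 * r%:R)%:E)%E].
Proof.
move=> v1.
pose E (b : bool) j w := expR (\sum_i ((-1) ^+ b * v j i) * g i w).
have mE b j : measurable_fun setT (E b j).
  by apply: measurableT_comp => //; exact: measurable_gaussian_sum.
have E0 b j w : 0 <= E b j w by exact: expR_ge0.
have mEE j : measurable_fun setT (fun w => E true j w + E false j w).
  exact: measurable_funD.
exists (fun w => \sum_j (E true j w + E false j w)); split.
- exact: measurable_sum.
- by move=> w; apply: sumr_ge0 => j _; rewrite addr_ge0.
- move=> w; apply: ler_sum => j _; set S := \sum_i _.
  have -> : E true j w = expR (- S).
    rewrite /E /S -sumrN; congr expR; apply: eq_bigr => i _.
    by rewrite expr1 mulN1r mulNr.
  have -> : E false j w = expR S.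
    by rewrite /E /S; congr expR; apply: eq_bigr => i _; rewrite expr0 mul1r.
  have := expR_ge1Dx S; have := expR_ge1Dx (- S).
  have := expR_ge0 S; have := expR_ge0 (- S).
  case: (ler0P S); lra.
- under eq_integral do rewrite -sumEFin.
  rewrite ge0_integral_sum//=; last 2 first.
  + by move=> j; apply/measurable_EFinP.
  + by move=> j w _; rewrite lee_fin addr_ge0.
  have IE b j : (\int[P]_w (E b j w)%:E = (expR 2^-1)%:E)%E.
    rewrite (gaussian_sum_mgf ind gauss); congr (expR _)%:E.
    under eq_bigr do rewrite exprMn sqrr_sign mul1r.
    by rewrite v1 mul1r.
  apply: (@le_trans _ _ (\sum_(j < r) (4 : R)%:E)%E).
    apply: lee_sum => j _.
    under eq_integral do rewrite EFinD.
    rewrite ge0_integralD//=; last 4 first.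
    + by move=> w _; rewrite lee_fin.
    + exact/measurable_EFinP.
    + by move=> w _; rewrite lee_fin.
    + exact/measurable_EFinP.
    rewrite !IE -EFinD lee_fin; have := expR_half_le2; lra.
  by rewrite sumEFin lee_fin sumr_const card_ord mulr_natr.
Qed.

End GaussianMaxima.

(** * Maurey's lemma from infratype *)

Section Maurey.
Context {R : realType} {X : normedModType R} {M : R}.
Hypothesis infra : infratype2_bound X M.

Lemma min_signed_norm_attained m (x : 'I_m -> X) :
  exists s : 'I_m -> bool,
    min_signed_norm x = `|\sum_i (-1) ^+ s i *: x i|.
Proof.
rewrite /min_signed_norm; elim/big_ind: _ => [|a b [s ->] [s' ->]|eta _].
- by exists (fun=> false); under [in RHS]eq_bigr do rewrite expr0 scale1r.
- by rewrite minEle; case: ifP => _; [exists s|exists s'].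
- by exists eta.
Qed.

Lemma infratype_signs (I : finType) (x : I -> X) :
  exists s : I -> bool, `|\sum_i (-1) ^+ s i *: x i| <=
    M * Num.sqrt (\sum_i `|x i| ^+ 2).
Proof.
have [s sE] := min_signed_norm_attained (fun k : 'I_#|I| => x (enum_val k)).
exists (fun i => s (enum_rank i)).
have := infra (fun k : 'I_#|I| => x (enum_val k)); rewrite sE.
rewrite (reindex (@enum_val I predT))/=; last exact/onW_bij/enum_val_bij.
rewrite [in X in _ -> _ <= M * Num.sqrt X](reindex (@enum_val I predT))/=;
  last exact/onW_bij/enum_val_bij.
by under [in X in _ -> `|X| <= _]eq_bigr do rewrite enum_valK.
Qed.

Lemma infratype_ge1 (x : X) : x != 0 -> 1 <= M.
Proof.
move=> x0; have [s] := infratype_signs (fun _ : unit => x).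
rewrite !(big_pred1 tt); try by case.
by rewrite normrZ normrX normrN1 expr1n mul1r sqrtr_sqr normr_id
  ler_pMl ?normr_gt0.
Qed.

Hypothesis M1 : 1 <= M.
Let M0 : 0 <= M. Proof. exact: le_trans M1. Qed.

Context {I : finType}.
Variable z : I -> X.
Hypothesis z1 : forall i, `|z i| <= 1.

(** Even multiplicities are halved exactly and odd ones are rounded according to
the signs given by infratype, so the error is a signed sum of at most
sum_i n_i vectors of the unit ball. Changing all signs if necessary, at least
as many multiplicities are rounded down as up. *)
Lemma halve_multiset (n : I -> nat) : exists n' : I -> nat,
  (2 * \sum_i n' i <= \sum_i n i)%N /\
  `|\sum_i z i *+ n i - (\sum_i z i *+ n' i) *+ 2| <=
    M * Num.sqrt (\sum_i n i)%:R.
Proof.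
pose x i := z i *+ odd (n i).
have [s0 s0P] := infratype_signs x.
have {s0P} s0P : `|\sum_i (-1) ^+ s0 i *: x i| <= M * Num.sqrt (\sum_i n i)%:R.
  apply: le_trans s0P _; rewrite ler_wpM2l// ler_wsqrtr// natr_sum.
  apply: ler_sum => i _; rewrite /x.
  have [no|_] := boolP (odd (n i)); last by rewrite mulr0n normr0 expr0n.
  rewrite mulr1n (@le_trans _ _ 1)//; first by rewrite expr_le1.
  by rewrite ler1n; case: (n i) no.
have [s sP sgn] : exists2 s : I -> bool,
    `|\sum_i (-1) ^+ s i *: x i| <= M * Num.sqrt (\sum_i n i)%:R &
    0 <= \sum_i (-1) ^+ s i * (odd (n i))%:R :> R.
  have [H|H] := leP 0 (\sum_i (-1) ^+ s0 i * (odd (n i))%:R : R).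
    by exists s0.
  exists (fun i => ~~ s0 i).
    under [in leLHS]eq_bigr do rewrite signrN scaleNr.
    by rewrite sumrN normrN.
  under eq_bigr do rewrite signrN mulNr.
  by rewrite sumrN oppr_ge0 ltW.
pose n' i := (s i * odd (n i) + (n i)./2)%N.
have nE i : (n i)%:R - 2 * (n' i)%:R = (-1) ^+ s i * (odd (n i))%:R :> R.
  rewrite -[in LHS](odd_double_half (n i)) /n' -mul2n !natrD !natrM.
  by case: (s i); case: (odd (n i)); rewrite /= ?expr0 ?expr1; ring.
exists n'; split.
  rewrite -(ler_nat R) natrM !natr_sum -subr_ge0 mulr_sumr -sumrB.
  by under eq_bigr do rewrite nE.
rewrite -sumrMnl -sumrB.
under [in leLHS]eq_bigr => i _.
  have -> : z i *+ n i - z i *+ n' i *+ 2 = (-1) ^+ s i *: x i.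
    rewrite /x -mulrnA -!(scaler_nat _ (z i)). rewrite [RHS]scalerA -scalerBl -nE.
    by rewrite natrM [_ * 2]mulrC.
  over.
exact: sP.
Qed.

(** The ratio of the geometric series of the errors of successive halvings. *)
Let rho : R := Num.sqrt 2 / 2.

(** Halving a multiset of size K 2^L costs M sqrt (K 2^L), which after division
by 2^L is M sqrt K rho^L: the errors form a geometric series of ratio
rho = 1 / sqrt 2 <= 3 / 4. *)
Lemma iterate_halving K L (n : I -> nat) : (\sum_i n i <= K * 2 ^ L)%N ->
  exists n' : I -> nat, (\sum_i n' i <= K)%N /\
  `|(2 ^+ L)^-1 *: (\sum_i z i *+ n i) - \sum_i z i *+ n' i| <=
    3 * M * Num.sqrt K%:R * (1 - rho ^+ L).
Proof.
have s2 : Num.sqrt (2 : R) ^+ 2 = 2 by rewrite sqr_sqrtr.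
have s20 : 0 <= Num.sqrt (2 : R) by exact: sqrtr_ge0.
have rho0 : 0 <= rho by rewrite divr_ge0.
have rho34 : rho <= 3 / 4 by rewrite /rho; nra.
elim: L n => [|L IHL] n nK.
  exists n; split; first by rewrite muln1 in nK.
  by rewrite expr0 invr1 scale1r !subrr normr0 mulr0.
have [n1 [n1n n1P]] := halve_multiset n.
have n1K : (\sum_i n1 i <= K * 2 ^ L)%N.
  by rewrite -(leq_pmul2l (ltn0Sn 1)) (leq_trans n1n)// (leq_trans nK)// expnS mulnCA.
have [n' [n'K n'P]] := IHL n1 n1K.
exists n'; split=> //.
set a := \sum_i z i *+ n i in n1P *; set b := \sum_i z i *+ n1 i in n1P n'P *.
set c := \sum_i z i *+ n' i in n'P *.
have -> : (2 ^+ L.+1)^-1 *: a - c =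
    (2 ^+ L.+1)^-1 *: (a - b *+ 2) + ((2 ^+ L)^-1 *: b - c).
  rewrite scalerBr addrA; congr (_ - c).
  rewrite -(scaler_nat 2 b) scalerA exprS invfM mulrAC mulVf// mul1r.
  by rewrite subrK.
apply: le_trans (ler_normD _ _) _.
rewrite normrZ ger0_norm; last by rewrite invr_ge0 exprn_ge0.
have step : (2 ^+ L.+1)^-1 * `|a - b *+ 2| <= M * Num.sqrt K%:R * rho ^+ L.+1.
  have H : `|a - b *+ 2| <= M * (Num.sqrt K%:R * Num.sqrt 2 ^+ L.+1).
    apply: le_trans n1P _; rewrite ler_wpM2l//.
    have -> : Num.sqrt K%:R * Num.sqrt 2 ^+ L.+1 =
        Num.sqrt (K * 2 ^ L.+1)%:R :> R.
      rewrite natrM natrX sqrtrM// -[in RHS]s2 -exprM mulnC exprM sqrtr_sqr.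
      by rewrite ger0_norm// exprn_ge0.
    by rewrite ler_wsqrtr// ler_nat.
  rewrite mulrC ler_pdivrMr ?exprn_gt0// (le_trans H)//.
  rewrite /rho exprMn exprVn -!mulrA mulVf ?mulr1// expf_neq0//.
have sK : 0 <= M * Num.sqrt K%:R by rewrite mulr_ge0// sqrtr_ge0.
have rL : 0 <= rho ^+ L by exact: exprn_ge0.
have := mulr_ge0 sK rL; move: step n'P.
rewrite [rho ^+ L.+1]exprS; set u := M * _; set v := rho ^+ L.
have -> : 3 * M * Num.sqrt K%:R = 3 * u by rewrite mulrA.
move=> step n'P uv.
have : u * v * rho <= u * v * (3 / 4) by rewrite ler_wpM2l.
lra.
Qed.

(** The weights are first rounded down to multiples of 1 / (K 2^L), with
L = #|I| large enough for the rounding error to be at most 1. *)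
Lemma maurey_multiset (K : nat) (l : I -> R) : (0 < K)%N ->
  (forall i, 0 <= l i) -> \sum_i l i <= 1 ->
  exists n : I -> nat, (\sum_i n i <= K)%N /\
  `|K%:R *: (\sum_i l i *: z i) - \sum_i z i *+ n i| <=
    4 * M * Num.sqrt K%:R.
Proof.
move=> K0 l0 l1; pose L := #|I|.
pose N : R := K%:R * 2 ^+ L.
have N0 : 0 <= N by rewrite mulr_ge0// exprn_ge0.
pose n i := Num.truncn (N * l i).
have nl i : (n i)%:R <= N * l i by rewrite truncn_le mulr_ge0.
have ln i : N * l i < (n i)%:R + 1 by rewrite natr1; exact: truncnS_gt.
have nK : (\sum_i n i <= K * 2 ^ L)%N.
  rewrite -(ler_nat R) natr_sum natrM natrX.
  apply: le_trans (ler_sum _ (fun i _ => nl i)) _.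
  by rewrite -mulr_sumr ler_piMr.
have [n' [n'K n'P]] := iterate_halving nK.
exists n'; split=> //.
set a := \sum_i z i *+ n i in n'P *; set c := \sum_i z i *+ n' i in n'P *.
have round : `|K%:R *: (\sum_i l i *: z i) - (2 ^+ L)^-1 *: a| <= 1.
  have -> : K%:R *: (\sum_i l i *: z i) - (2 ^+ L)^-1 *: a =
      (2 ^+ L)^-1 *: \sum_i (N * l i - (n i)%:R) *: z i.
    under [in RHS]eq_bigr do rewrite scalerBl -scalerA.
    rewrite sumrB -scaler_sumr scalerBr scalerA /N.
    rewrite mulrCA mulVf ?mulr1 ?expf_neq0//; congr (_ - _ *: _).
    by apply: eq_bigr => i _; rewrite scaler_nat.
  rewrite normrZ ger0_norm; last by rewrite invr_ge0 exprn_ge0.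
  rewrite mulrC ler_pdivrMr ?exprn_gt0// mul1r.
  apply: le_trans (ler_norm_sum _ _ _) _.
  apply: (@le_trans _ _ (\sum_(i : I) 1)).
    apply: ler_sum => i _; rewrite normrZ.
    have H : `|N * l i - (n i)%:R| <= 1.
      by have := nl i; have := ln i; rewrite ler_norml; lra.
    by rewrite mulr_ile1.
  by rewrite sumr_const -natrX ler_nat ltnW// ltn_expl.
have sK : 1 <= Num.sqrt K%:R :> R by rewrite -[leLHS]sqrtr1 ler_wsqrtr// ler1n.
have rL : 0 <= rho ^+ L by rewrite exprn_ge0// divr_ge0// sqrtr_ge0.
have Ms : 1 <= M * Num.sqrt K%:R.
  exact: mulr_ege1.
have -> : K%:R *: (\sum_i l i *: z i) - c =
   (K%:R *: (\sum_i l i *: z i) - (2 ^+ L)^-1 *: a) + ((2 ^+ L)^-1 *: a - c).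
  by rewrite addrA subrK.
apply: le_trans (ler_normD _ _) _; move: n'P round.
have := mulr_ge0 (le_trans ler01 Ms) rL.
by rewrite -(mulrA 3) -(mulrA 4); lra.
Qed.

Lemma sum_nth_option (s : seq I) K : (size s <= K)%N ->
  \sum_(k < K) oapp z 0 (nth None (map Some s) k) = \sum_(i <- s) z i.
Proof.
elim: s K => [|a s IHs] [|K]//= sK; rewrite ?big_nil ?big_ord0//.
  by apply: big1 => k _; rewrite nth_nil.
by rewrite big_ord_recl/= big_cons IHs.
Qed.

Lemma multiset_as_list (n : I -> nat) K : (\sum_i n i <= K)%N ->
  exists F : {ffun 'I_K -> option I},
    \sum_i z i *+ n i = \sum_k oapp z 0 (F k).
Proof.
pose s := flatten [seq nseq (n i) i | i <- index_enum I].
have ss : size s = (\sum_i n i)%N.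
  rewrite size_flatten /shape -map_comp sumnE big_map.
  by apply: eq_bigr => i _; rewrite /= size_nseq.
move=> nK; exists [ffun k : 'I_K => nth None (map Some s) k].
under [RHS]eq_bigr do rewrite ffunE.
rewrite sum_nth_option ?ss// /s big_flatten big_map.
apply: eq_bigr => i _; rewrite big_nseq.
by elim: (n i) => [|k IHk]/=; rewrite ?mulr0n// mulrS IHk.
Qed.

(** Multisets of size at most K are coded by K-tuples, with None for a missing
vector: this gives at most (#|I| + 1)^K approximants. *)
Lemma maurey (K : nat) (l : I -> R) : (0 < K)%N ->
  (forall i, 0 <= l i) -> \sum_i l i <= 1 ->
  exists F : {ffun 'I_K -> option I},
  `|K%:R *: (\sum_i l i *: z i) - \sum_k oapp z 0 (F k)| <=
    4 * M * Num.sqrt K%:R.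
Proof.
move=> K0 l0 l1; have [n [nK nP]] := maurey_multiset K0 l0 l1.
by have [F FE] := multiset_as_list nK; exists F; rewrite -FE.
Qed.

End Maurey.

Lemma signed_maurey {R : realType} {X : normedModType R} {M : R}
    {I : finType} (z : I -> X) (K : nat) (a : I -> R) :
  infratype2_bound X M -> 1 <= M -> (forall i, `|z i| <= 1) -> (0 < K)%N ->
  \sum_i `|a i| <= 1 ->
  exists F : {ffun 'I_K -> option (I * bool)},
  `|K%:R *: (\sum_i a i *: z i) -
    \sum_k oapp (fun p : I * bool => (-1) ^+ p.2 *: z p.1) 0 (F k)| <=
    4 * M * Num.sqrt K%:R.
Proof.
move=> infra M1 z1 K0 a1.
pose l (p : I * bool) := if p.2 == (a p.1 < 0) then `|a p.1| else 0.
pose zz (p : I * bool) := (-1) ^+ p.2 *: z p.1.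
have zz1 p : `|zz p| <= 1 by rewrite normrZ normrX normrN1 expr1n mul1r.
have l0 p : 0 <= l p by rewrite /l; case: ifP.
have sum_bool (V : zmodType) (f : bool -> V) b0 :
    (forall b, b != b0 -> f b = 0) -> \sum_b f b = f b0.
  by move=> H; rewrite (bigD1 b0)//= big1 ?addr0.
have l1 : \sum_p l p <= 1.
  rewrite -(pair_bigA _ (fun i b => l (i, b)))/=.
  apply: le_trans a1; apply: ler_sum => i _.
  by rewrite (sum_bool _ _ (a i < 0)) /l/= ?eqxx// => b /negbTE ->.
have [F FP] := maurey infra M1 zz1 K0 l0 l1.
exists F; suff <- : \sum_p l p *: zz p = \sum_i a i *: z i by [].
rewrite -(pair_bigA _ (fun i b => l (i, b) *: zz (i, b)))/=.
apply: eq_bigr => i _; rewrite (sum_bool _ _ (a i < 0)) /l/=.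
  by rewrite eqxx /zz scalerA/= mulrC mulr_sign_norm.
by move=> b /negbTE ->; rewrite scale0r.
Qed.
(** * Entropy of the dual ball *)

(** A list of K signed vectors of a family indexed by I, where None stands for the
zero vector. *)
Definition code (I : finType) (K : nat) : finType :=
  {ffun 'I_K -> option (I * bool)}.

Lemma card_code I K : #|code I K| = ((2 * #|I|).+1 ^ K)%N.
Proof. by rewrite card_ffun card_ord card_option card_prod card_bool mulnC. Qed.

Section DualMetric.
Context {R : realType} {X : normedModType R}.

Definition dist2 {I : finType} (y : I -> X) (f f' : {linear X -> R^o}) : R :=
  \sum_i (f (y i) - f' (y i)) ^+ 2.

Lemma dual_ball_ge (f : {linear X -> R^o}) x : in_dual_ball f -> - `|x| <= f x.
Proof. by move=> /(_ (- x)); rewrite normrN linearN /= => H; rewrite lerNl. Qed.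

Lemma in_dual_ball0 : in_dual_ball (\0 : {linear X -> R^o}).
Proof. by move=> x /=. Qed.

Context {M : R} {I : finType} (y : I -> X).
Hypotheses (infra : infratype2_bound X M) (M1 : 1 <= M).
Hypothesis y1 : \sum_i `|y i| ^+ 2 <= 1.

(** With |a_i| |y_i| <= (a_i^2 / t + t |y_i|^2) / 2, where a_i is the increment of
f at y_i, the sum of the a_i y_i lies in t times the absolutely convex hull of
the normalized y_i. *)
Lemma code_increment (K : nat) (t : R) (f f0 : {linear X -> R^o}) :
  (0 < K)%N -> 0 < t -> dist2 y f f0 <= t ^+ 2 ->
  exists F : code I K,
  `|(K%:R / t) *: (\sum_i (f (y i) - f0 (y i)) *: y i) -
    \sum_k oapp (fun p : I * bool => (-1) ^+ p.2 *: (`|y p.1|^-1 *: y p.1)) 0 (F k)| <=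
    4 * M * Num.sqrt K%:R.
Proof.
move=> K0 t0 ff0.
pose a i := t^-1 * (f (y i) - f0 (y i)) * `|y i|.
pose z i := `|y i|^-1 *: y i.
have z1 i : `|z i| <= 1.
  rewrite normrZ normfV normr_id; have [->|yi] := eqVneq (y i) 0.
    by rewrite normr0 mulr0.
  by rewrite mulVf// normr_eq0.
have az i : a i *: z i = t^-1 *: ((f (y i) - f0 (y i)) *: y i).
  rewrite /a /z !scalerA; have [->|yi] := eqVneq (y i) 0; first by rewrite !scaler0.
  by rewrite mulfK// normr_eq0.
have a1 : \sum_i `|a i| <= 1.
  have H i : `|a i| <= (t ^- 2 * (f (y i) - f0 (y i)) ^+ 2 + `|y i| ^+ 2) / 2.
    rewrite -exprVn -exprMn /a normrM normr_id.
    set e := t^-1 * _; rewrite -(real_normK (num_real e)).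
    by have := sqr_ge0 (`|e| - `|y i|); lra.
  apply: le_trans (ler_sum _ (fun i _ => H i)) _.
  rewrite -mulr_suml big_split/= -mulr_sumr -/(dist2 y f f0).
  have : t ^- 2 * dist2 y f f0 <= 1 by rewrite mulrC ler_pdivrMr ?exprn_gt0// mul1r.
  by move: y1; set S := \sum_i _; set D := t ^- 2 * _; lra.
have [F FP] := signed_maurey infra M1 z1 K0 a1.
exists F; move: FP; under [X in K%:R *: X]eq_bigr do rewrite az.
by rewrite -scaler_sumr scalerA.
Qed.

(** Each code selects one functional close to it, when there is one. Two
functionals f, f' with the same code satisfy
|sum_i (f - f')(y_i) y_i| <= 8 M t / sqrt K <= t^2 / 8, and the squared distance
of f and f' is (f - f') evaluated at this vector, at most twice its norm. *)
Lemma local_net (K : nat) (t : R) (f0 : {linear X -> R^o}) :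
  0 < t -> (64 * M) ^+ 2 <= K%:R * t ^+ 2 -> in_dual_ball f0 ->
  exists r : code I K -> {linear X -> R^o},
    (forall F, in_dual_ball (r F) /\ dist2 y (r F) f0 <= t ^+ 2) /\
    forall f, in_dual_ball f -> dist2 y f f0 <= t ^+ 2 ->
      exists F, dist2 y f (r F) <= (t / 2) ^+ 2.
Proof.
move=> t0 Kt f0B.
have K0 : (0 < K)%N.
  rewrite -(ltr0n R) ltNge; apply/negP => K0.
  have : K%:R * t ^+ 2 <= 0 by rewrite mulr_le0_ge0// sqr_ge0.
  have M64 : 1 <= 64 * M by have := M1; lra.
  have : 1 <= (64 * M) ^+ 2 by rewrite expr_ge1// (le_trans ler01).
  by move: Kt; lra.
pose S f : X := \sum_i (f (y i) - f0 (y i)) *: y i.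
pose dec (F : code I K) : X :=
  \sum_k oapp (fun p : I * bool => (-1) ^+ p.2 *: (`|y p.1|^-1 *: y p.1)) 0 (F k).
pose matches (F : code I K) (f : {linear X -> R^o}) :=
  [/\ in_dual_ball f, dist2 y f f0 <= t ^+ 2 &
   `|(K%:R / t) *: S f - dec F| <= 4 * M * Num.sqrt K%:R].
have /choice[r rP] : forall F, exists f, (in_dual_ball f /\ dist2 y f f0 <= t ^+ 2)
    /\ ((exists f', matches F f') -> matches F f).
  move=> F; have [[f fP]|nf] := pselect (exists f, matches F f).
    by exists f; split=> //; case: fP.
  exists f0; split=> //; split=> //.
  by rewrite /dist2 big1 ?sqr_ge0// => i _; rewrite subrr expr0n.
exists r; split=> [F|f fB ff0]; first exact: (rP F).1.
have [F FP] := code_increment K0 t0 ff0.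
exists F; have [_ /(_ (ex_intro _ f (And3 fB ff0 FP)))] := rP F.
set f' := r F => -[f'B f'f0 f'P].
have sqK : 0 < Num.sqrt (K%:R : R) by rewrite sqrtr_gt0 ltr0n.
have sqKE : Num.sqrt (K%:R : R) ^+ 2 = K%:R by rewrite sqr_sqrtr.
pose D : X := \sum_i (f (y i) - f' (y i)) *: y i.
have DE : (K%:R / t) *: D =
    ((K%:R / t) *: S f - dec F) - ((K%:R / t) *: S f' - dec F).
  rewrite opprB addrA subrK -scalerBr /S -sumrB; congr (_ *: _).
  by apply: eq_bigr => i _; rewrite -scalerBl; congr (_ *: _); ring.
have DK : (K%:R / t) * `|D| <= 8 * M * Num.sqrt K%:R.
  have -> : (K%:R / t) * `|D| = `|(K%:R / t) *: D|.
    by rewrite normrZ ger0_norm// divr_ge0// ltW.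
  rewrite DE; apply: le_trans (ler_normB _ _) _.
  by move: FP f'P; rewrite -/(S f) -/(dec F); lra.
have dD : dist2 y f f' <= 2 * `|D|.
  have -> : dist2 y f f' = f D - f' D.
    rewrite /D (dual_sum _ f) (dual_sum _ f') -sumrB; apply: eq_bigr => i _.
    by rewrite -mulrBr expr2.
  by have := fB D; have := dual_ball_ge D f'B; lra.
have Dt : Num.sqrt K%:R * `|D| <= 8 * M * t.
  rewrite -(ler_pM2l sqK) mulrA -expr2 sqKE.
  move: DK; rewrite mulrAC ler_pdivrMr//; lra.
have Mt : 64 * M <= Num.sqrt K%:R * t.
  have M0 : 0 <= M by exact: le_trans M1.
  have N1 : 0 <= 64 * M by rewrite mulr_ge0.
  have N2 : 0 <= Num.sqrt K%:R * t by rewrite mulr_ge0// ltW.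
  by rewrite -ler_sqr ?nnegrE// [leRHS]exprMn sqKE.
have D8 : 8 * `|D| <= t ^+ 2.
  rewrite -(ler_pM2l sqK).
  have : 64 * M * t <= Num.sqrt K%:R * t * t by rewrite ler_wpM2r// ltW.
  by move: Dt; lra.
by apply: le_trans dD _; rewrite expr_div_n; lra.
Qed.

End DualMetric.

(** * Chaining *)

Section Chaining.
Context {R : realType} {X : normedModType R} {M : R}.
Hypotheses (infra : infratype2_bound X M) (M1 : 1 <= M).
Context {I : finType} (y : I -> X) {m : nat} (x : 'I_m -> X).
Hypothesis y1 : \sum_i `|y i| ^+ 2 <= 1.
Hypothesis xy : forall f f' : {linear X -> R^o}, dist2 x f f' = dist2 y f f'.
Context d (T : measurableType d) (P : probability T R).
Context (g : 'I_m -> {RV P >-> R}).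
Hypothesis ind : independent_RVs g.
Hypothesis gauss : forall i, standard_gaussian (g i).
Variables (K0 : nat) (A : R).
Hypotheses (K0M : (64 * M) ^+ 2 <= K0%:R) (A1 : 1 <= A).
Hypothesis AK : ((2 * #|I|).+1 ^ (K0 * 4))%:R <= expR (A ^+ 2 / 2).

Let G w : X := \sum_i g i w *: x i.

(** A net of scale 2^-k whose values at G are dominated by one integrable
function. The refinement of the net links each new functional to an old one at
distance at most 2^-k, so the new function is the old one plus a bound of the
maximum of Gaussian sums of variance at most 4^-k. *)
Lemma chaining (k : nat) :
  exists (J : finType) (r : J -> {linear X -> R^o}) (Phi : T -> R),
  [/\ forall j, in_dual_ball (r j),
      forall f, in_dual_ball f -> exists j, dist2 y f (r j) <= (2 ^- k) ^+ 2,
      (#|J| <= (2 * #|I|).+1 ^ (K0 * 4 ^ k))%N,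
      [/\ measurable_fun setT Phi, forall w, 0 <= Phi w &
          (\int[P]_w (Phi w)%:E <= (2 * k%:R * A)%:E)%E] &
      forall j w, r j (G w) <= Phi w].
Proof.
have A0 : 0 < A by exact: lt_le_trans A1.
elim: k => [|k [J [r [Phi [rB rnet rJ [mPhi Phi0 IPhi] rPhi]]]]].
  exists unit, (fun=> \0), (fun=> 0); split=> //.
  - by move=> _; exact: in_dual_ball0.
  - move=> f fB; exists tt; rewrite expr0 invr1 expr1n; apply: le_trans y1.
    apply: ler_sum => i _ /=; rewrite subr0.
    rewrite -[leLHS]real_normK ?num_real// ler_pXn2r ?nnegrE//.
    by rewrite ler_norml dual_ball_ge// fB.
  - by rewrite card_unit expn_gt0.
  - split=> //; last by rewrite integral0 mulr0 mul0r.
pose t : R := 2 ^- k.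
have t0 : 0 < t by rewrite invr_gt0 exprn_gt0.
have t1 : t <= 1 by rewrite invf_le1 ?exprn_gt0// exprn_ege1// ler1n.
pose K := (K0 * 4 ^ k)%N.
have KM : (64 * M) ^+ 2 <= K%:R * t ^+ 2.
  rewrite /K natrM natrX /t exprVn -exprM mulnC exprM.
  have -> : (2 : R) ^+ 2 = 4%:R by rewrite -natrX.
  by rewrite mulfK// expf_neq0.
have /choice[r' r'P] := fun j => local_net infra M1 y1 t0 KM (rB j).
pose v (p : (J * code I K)%type) i := r' p.1 p.2 (x i) - r p.1 (x i).
have vt p : \sum_i v p i ^+ 2 <= t ^+ 2.
  by rewrite -/(dist2 x _ _) xy; exact: ((r'P p.1).1 p.2).2.
have JJ : (#|{: J * code I K}| <= (2 * #|I|).+1 ^ (K0 * 4 ^ k.+1))%N.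
  rewrite card_prod card_code; apply: leq_trans (leq_mul rJ (leqnn _)) _.
  by rewrite -expnD leq_pexp2l// expnS mulnCA addnn -mul2n leq_mul2r orbT.
have JA : #|{: J * code I K}|%:R <= expR (A ^+ 2 / (2 * t ^+ 2)).
  apply: (@le_trans _ _ (((2 * #|I|).+1 ^ (K0 * 4)) ^ (4 ^ k))%:R).
    by rewrite ler_nat -expnM -mulnA -expnS.
  rewrite natrX; apply: le_trans (lerXn2r _ _ _ AK) _;
    rewrite ?nnegrE ?expR_ge0//.
  rewrite -expRM_natl ler_expR le_eqVlt; apply/orP; left; apply/eqP.
  rewrite /t exprVn -exprM mulnC exprM natrX.
  have -> : (2 : R) ^+ 2 = 4%:R by rewrite -natrX.
  by field; rewrite expf_neq0.
have [Psi [mPsi Psi0 PsiP IPsi]] := gaussian_max_dominated ind gauss t0 A0 vt JA.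
exists (J * code I K : finType)%type, (fun p => r' p.1 p.2), (fun w => Phi w + Psi w); split=> //.
- by move=> p; exact: ((r'P p.1).1 p.2).1.
- move=> f fB; have [j fj] := rnet f fB.
  have [F fF] := (r'P j).2 f fB fj; exists (j, F).
  have -> : 2 ^- k.+1 = t / 2 by rewrite /t exprS invfM mulrC.
  exact: fF.
- split; first exact: measurable_funD.
    by move=> w; rewrite addr_ge0.
  under eq_integral do rewrite EFinD.
  rewrite ge0_integralD//=; last 4 first.
  + by move=> w _; rewrite lee_fin.
  + exact/measurable_EFinP.
  + by move=> w _; rewrite lee_fin.
  + exact/measurable_EFinP.
  apply: le_trans (leeD IPhi IPsi) _.
  rewrite -EFinD lee_fin -natr1.
  have : t ^+ 2 / A <= A.
    rewrite ler_pdivrMr// (@le_trans _ _ 1)//; first by rewrite expr_le1// ltW.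
    by rewrite -expr2 expr_ge1// ltW.
  lra.
- move=> p w.
  have -> : r' p.1 p.2 (G w) = r p.1 (G w) + \sum_i v p i * g i w.
    rewrite /G !dual_sum -big_split/=; apply: eq_bigr => i _.
    by rewrite /v; ring.
  by rewrite lerD.
Qed.

(** If u_i = f x_i - r_j x_i is the remainder at the last scale 2^-k <= 1 / n, then
u is a combination of q <= n orthonormal vectors with coefficients at most
2^-k, so the remainder contributes at most 4 q 2^-k <= 4. *)
Lemma gaussian_norm_dominated (n k : nat) : Vector.axiom n X ->
  n%:R <= 2 ^+ k :> R ->
  exists Phi : T -> R, [/\ measurable_fun setT Phi, forall w, 0 <= Phi w,
    forall w, `|G w| <= Phi w &
    (\int[P]_w (Phi w)%:E <= (2 * k%:R * A + 4)%:E)%E].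
Proof.
move=> vX nk.
have [J [r [Phi [rB rnet _ [mPhi Phi0 IPhi] rPhi]]]] := chaining k.
have [co [e fE]] := dual_coordinates vX.
pose B : 'M[R]_(n, m) := \matrix_(j, i) co (x i) j.
have [q [Q [qn QQ BQ]]] := gram_schmidt B.
have Q1 (l : 'I_q) : \sum_i Q l i ^+ 2 = 1.
  have /matrixP/(_ l l) := QQ; rewrite !mxE eqxx => QQl; rewrite -[RHS]QQl.
  by apply: eq_bigr => i _; rewrite !mxE expr2.
have [Psi [mPsi Psi0 PsiP IPsi]] := gaussian_abs_dominated ind gauss Q1.
pose t : R := 2 ^- k.
have t0 : 0 < t by rewrite invr_gt0 exprn_gt0.
exists (fun w => Phi w + t * Psi w); split.
- by apply: measurable_funD => //; exact: measurable_funM.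
- by move=> w; rewrite addr_ge0// mulr_ge0// ltW.
- move=> w; have [f fB <-] := norming_functional (G w) vX.
  have [j fj] := rnet f fB.
  pose u i := f (x i) - r j (x i).
  pose c l := \sum_i u i * Q l i.
  have uQ i : u i = \sum_l c l * Q l i.
    have uB : \row_i u i = (\row_k (f (e k) - r j (e k))) *m B.
      apply/rowP => i'; rewrite !mxE /u (fE f (x i')) (fE (r j) (x i')) -sumrB.
      by apply: eq_bigr => k' _; rewrite !mxE -mulrBr mulrC.
    have : \row_i u i = \row_i u i *m Q^T *m Q by rewrite uB -!mulmxA (mulmxA B) BQ.
    move=> /rowP/(_ i); rewrite !mxE => ->; apply: eq_bigr => l _.
    by congr (_ * _); rewrite !mxE; apply: eq_bigr => i' _; rewrite !mxE.
  have ut : \sum_i u i ^+ 2 <= t ^+ 2 by rewrite -/(dist2 x f (r j)) xy.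
  have ct l : `|c l| <= t.
    (* Bessel's inequality for one vector *)
    have H : c l ^+ 2 <= \sum_i u i ^+ 2.
      have : 0 <= \sum_i (u i - c l * Q l i) ^+ 2.
        by apply: sumr_ge0 => i _; exact: sqr_ge0.
      under eq_bigr do rewrite sqrrB exprMn mulrCA -mulr_natl.
      rewrite big_split/= sumrB -!mulr_sumr Q1 -/(c l); lra.
    rewrite -(@ler_pXn2r _ 2) ?nnegrE ?(ltW t0)// real_normK ?num_real//.
    exact: le_trans ut.
  have -> : f (G w) = r j (G w) + \sum_l c l * \sum_i Q l i * g i w.
    under [in RHS]eq_bigr do rewrite mulr_sumr.
    rewrite exchange_big/= /G !dual_sum -big_split/=; apply: eq_bigr => i _.
    under eq_bigr do rewrite mulrA.
    by rewrite -mulr_suml -uQ /u; ring.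
  rewrite lerD// (le_trans (ler_norm _))// (le_trans (ler_norm_sum _ _ _))//.
  apply: (@le_trans _ _ (t * \sum_l `|\sum_i Q l i * g i w|)).
    by rewrite mulr_sumr; apply: ler_sum => l _; rewrite normrM ler_wpM2r.
  by rewrite ler_pM2l.
- under eq_integral do rewrite EFinD.
  rewrite ge0_integralD//=; last 4 first.
  + by move=> w _; rewrite lee_fin.
  + exact/measurable_EFinP.
  + by move=> w _; rewrite lee_fin mulr_ge0// ltW.
  + by apply/measurable_EFinP; exact: measurable_funM.
  rewrite EFinD leeD//.
  under eq_integral do rewrite EFinM.
  rewrite ge0_integralZl//=; last 3 first.
  + exact/measurable_EFinP.
  + by move=> w _; rewrite lee_fin.
  + by rewrite lee_fin ltW.
  apply: (@le_trans _ _ (t%:E * (4 * q%:R)%:E)%E).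
    by rewrite lee_pmul2l ?lte_fin.
  rewrite -EFinM lee_fin.
  rewrite /t mulrC ler_pdivrMr ?exprn_gt0// ler_pM2l// (le_trans _ nk)//.
  by rewrite ler_nat.
Qed.

End Chaining.

(** * Reduction to n^2 vectors *)

Section Reduction.
Context {R : realType} {X : normedModType R}.

(** The squared distance is linear in the tensors of coordinates of x_i (x) x_i,
which live in dimension n^2; the theorem of Caratheodory is applied to them
with the costs |x_i|^2. *)
Lemma reduce_covariance n m (x : 'I_m -> X) : Vector.axiom n X ->
  exists (I : finType) (y : I -> X), [/\ (#|I| <= n * n)%N,
    \sum_i `|y i| ^+ 2 <= \sum_i `|x i| ^+ 2 &
    forall f f' : {linear X -> R^o}, dist2 x f f' = dist2 y f f'].
Proof.
move=> /dual_coordinates[co [e fE]].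
pose coV z : 'rV[R]_n := \row_k co z k.
pose tensor z : 'rV[R]_(n * n) := mxvec ((coV z)^T *m coV z).
have [w' [w'0 w'd w'z w'c]] := @conic_caratheodory R m (n * n) (tensor \o x)
  (fun i => `|x i| ^+ 2) (fun=> 1) (fun i => sqr_ge0 _) (fun=> ler01).
pose S := finset (fun i => w' i != 0).
exists 'I_#|S|, (fun k => Num.sqrt (w' (enum_val k)) *: x (enum_val k)).
have sub_sum (F : 'I_m -> R) :
    \sum_(k < #|S|) w' (enum_val k) * F (enum_val k) = \sum_i w' i * F i.
  rewrite -(big_enum_val (fun i => w' i * F i)).
  rewrite [RHS](bigID (fun i => i \in S))/= [X in _ + X]big1 ?addr0//.
  by move=> i; rewrite inE negbK => /eqP ->; rewrite mul0r.
split.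
- by rewrite card_ord.
- under eq_bigr do rewrite normrZ exprMn ger0_norm ?sqrtr_ge0// sqr_sqrtr//.
  rewrite (sub_sum (fun i => `|x i| ^+ 2)); apply: le_trans w'c _.
  by under eq_bigr do rewrite mul1r.
- move=> f f'; pose h k := f (e k) - f' (e k).
  pose H : 'rV[R]_n := \row_k h k.
  pose q (u : 'rV[R]_(n * n)) : R := (H *m vec_mx u *m H^T) 0 0.
  have qE z : (f z - f' z) ^+ 2 = q (tensor z).
    have -> : f z - f' z = (coV z *m H^T) 0 0.
      rewrite (fE f z) (fE f' z) -sumrB mxE.
      by apply: eq_bigr => k _; rewrite !mxE /h mulrBr.
    rewrite /q /tensor mxvecK mulmxA -mulmxA.
    rewrite [RHS]mxE big_ord1 expr2; congr (_ * _).
    by rewrite -[H *m _]trmxK trmx_mul trmxK [RHS]mxE.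
  have qsum (c : 'I_m -> R) (u : 'I_m -> 'rV[R]_(n * n)) :
      q (\sum_i c i *: u i) = \sum_i c i * q (u i).
    rewrite /q linear_sum mulmx_sumr mulmx_suml summxE.
    apply: eq_bigr => i _.
    by rewrite linearZ/= -scalemxAr -scalemxAl mxE.
  transitivity (q (\sum_i 1 *: tensor (x i))).
    by rewrite qsum; apply: eq_bigr => i _; rewrite mul1r qE.
  rewrite -w'z qsum -sub_sum; apply: eq_bigr => i _ /=.
  rewrite (dualZ f) (dualZ f') -[in RHS]mulrBr exprMn sqr_sqrtr//; congr (_ * _).
  by rewrite qE.
Qed.

End Reduction.

(** * The comparison of type and infratype *)

(** The integral of a nonnegative function is the supremum over the simple
functions below it, which gives monotonicity for arbitrary functions such as the
norm of a random vector. *)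
Lemma le_integral_pointwise {R : realType} d (T : measurableType d)
    (mu : {measure set T -> \bar R}) (f1 f2 : T -> \bar R) :
  (forall x, 0 <= f1 x)%E -> (forall x, f1 x <= f2 x)%E ->
  (\int[mu]_x f1 x <= \int[mu]_x f2 x)%E.
Proof.
move=> f10 f12; have f20 x : (0 <= f2 x)%E by exact: le_trans (f12 x).
rewrite !ge0_integralTE//; apply: ereal_sup_le => _ [h /= hf <-].
by exists h => // x; exact: le_trans (hf x) (f12 x).
Qed.

Section Main.
Context {R : realType}.

Lemma double_square_lt_pow4 n : (2 <= n)%N -> ((2 * (n * n)).+1 <= n ^ 4)%N.
Proof.
move=> n2; rewrite (expnM n 2 2) -(mulnn n) -(mulnn (n * n)).
have : (4 <= n * n)%N by exact: (leq_mul n2 n2).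
by move: (n * n)%N => s s4; have := leq_mul s4 (leqnn s); lia.
Qed.

Lemma ln_ge_half n : (2 <= n)%N -> 1 / 2 <= ln (n%:R : R).
Proof.
move=> n2; have n0 : 0 < n%:R :> R by rewrite ltr0n ltnW.
rewrite -ler_expR lnK ?posrE//.
by rewrite div1r (le_trans expR_half_le2)// ler_nat.
Qed.

Lemma exists_dyadic n : (2 <= n)%N ->
  exists2 k, n%:R <= 2 ^+ k :> R & k%:R <= 4 * ln (n%:R : R).
Proof.
move=> n2; have n0 : (0 < n)%N by exact: ltnW.
have n0' : 0 < n%:R :> R by rewrite ltr0n.
exists (trunc_log 2 n).+1.
  by rewrite -natrX ler_nat ltnW// trunc_log_ltn.
set k := trunc_log 2 n.
have kn : (2 ^ k.+1 <= n ^ 2)%N.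
  by rewrite expnS -mulnn leq_mul// trunc_logP.
have : ln ((2 : R) ^+ k.+1) <= ln (n%:R ^+ 2).
  rewrite ler_ln ?posrE ?exprn_gt0//.
  by rewrite -!natrX ler_nat.
rewrite !lnXn// -[leLHS]mulr_natl -[leRHS]mulr_natl => H.
have := ln_ge_half (leqnn 2) => l2.
have : k.+1%:R * (1 / 2) <= k.+1%:R * ln (2 : R) by rewrite ler_wpM2l.
lra.
Qed.

(** The parameters: K0 is about (64 M)^2 and A is about M sqrt (log n), which makes
(2 #|I| + 1)^(4 K0) at most exp (A^2 / 2); the number k of scales is at most
4 log n, and the bound 2 k A + 4 is at most 16 A log n. *)
Lemma gaussian_norm_unit (X : normedModType R) (M : R) n m (x : 'I_m -> X)
    d (T : measurableType d) (P : probability T R) (g : 'I_m -> {RV P >-> R}) :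
  (2 <= n)%N -> Vector.axiom n X -> infratype2_bound X M -> 1 <= M ->
  \sum_i `|x i| ^+ 2 <= 1 ->
  independent_RVs g -> (forall i, standard_gaussian (g i)) ->
  exists Phi : T -> R, [/\ measurable_fun setT Phi, forall w, 0 <= Phi w,
    forall w, `|\sum_i g i w *: x i| <= Phi w &
    (\int[P]_w (Phi w)%:E <= (128 * (64 * M) * (ln n%:R `^ (3 / 2)))%:E)%E].
Proof.
move=> n2 vX infra M1 x1 ind gauss.
have [I [y [In yx xy]]] := reduce_covariance x vX.
have y1 := le_trans yx x1.
have n0 : 0 < n%:R :> R by rewrite ltr0n ltnW.
pose c := 64 * M.
have c1 : 1 <= c by rewrite /c; lra.
have c0 : 0 <= c by exact: le_trans c1.
have c2 : 1 <= c ^+ 2 by rewrite expr_ge1.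
have [K0 [K0c K0c1]] : exists K0 : nat,
    c ^+ 2 <= K0%:R /\ K0%:R <= c ^+ 2 + 1.
  exists (Num.truncn (c ^+ 2)).+1; split; first exact/ltW/truncnS_gt.
  by rewrite -natr1 lerD2r truncn_le exprn_ge0.
have K01 : 1 <= K0%:R :> R by exact: le_trans K0c.
have l2 := ln_ge_half n2.
set l := ln (n%:R : R) in l2.
have l0 : 0 < l by apply: lt_le_trans l2; lra.
have A20 : 0 <= 32 * (K0%:R * l) by rewrite mulr_ge0// mulr_ge0// ltW.
pose A := Num.sqrt (32 * (K0%:R * l)).
have A2 : A ^+ 2 = 32 * (K0%:R * l) by rewrite sqr_sqrtr.
have A1 : 1 <= A.
  rewrite -[leLHS]sqrtr1 ler_wsqrtr//.
  have : 1 * (1 / 2) <= K0%:R * l by rewrite ler_pM//; lra.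
  lra.
have AK : ((2 * #|I|).+1 ^ (K0 * 4))%:R <= expR (A ^+ 2 / 2).
  have H : ((2 * #|I|).+1 <= n ^ 4)%N.
    apply: (@leq_trans (2 * (n * n)).+1); first by rewrite ltnS leq_mul.
    exact: double_square_lt_pow4.
  apply: (@le_trans _ _ ((n ^ 4) ^ (K0 * 4))%:R).
    rewrite ler_nat leq_exp2r// muln_gt0 andbT -(ltr0n R).
    exact: lt_le_trans K01.
  rewrite -expnM natrX -[in leLHS](lnK n0) -expRM_natl ler_expR A2 -/l.
  by rewrite le_eqVlt; apply/orP; left; apply/eqP; rewrite !natrM; field.
have [k nk kn] := exists_dyadic n2.
have [Phi [mPhi Phi0 PhiP IPhi]] :=
  gaussian_norm_dominated infra M1 y1 xy ind gauss K0c A1 AK vX nk.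
exists Phi; split=> //; apply: le_trans IPhi _; rewrite lee_fin.
rewrite -/l in kn *.
have -> : l `^ (3 / 2) = l * Num.sqrt l.
  have -> : (3 / 2 : R) = 1 + 1 / 2 by field.
  rewrite powRD; last by rewrite gt_eqF// implybT.
  by rewrite powRr1 ?(ltW l0)// div1r powR12_sqrt// ltW.
have sl : 0 <= Num.sqrt l by exact: sqrtr_ge0.
have Ac : A <= 8 * (c * Num.sqrt l).
  have N : 0 <= 8 * (c * Num.sqrt l) by rewrite mulr_ge0// mulr_ge0.
  rewrite -ler_sqr ?nnegrE ?(le_trans ler01 A1)// A2.
  rewrite [leRHS]exprMn [(c * _) ^+ 2]exprMn sqr_sqrtr ?(ltW l0)//.
  have : K0%:R * l <= 2 * c ^+ 2 * l by rewrite ler_pM2r//; lra.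
  lra.
have lA : l * A <= l * (8 * (c * Num.sqrt l)) by rewrite ler_pM2l.
have kA : k%:R * A <= 4 * l * A by rewrite ler_wpM2r// (le_trans ler01).
have lA1 : 1 / 2 * A <= l * A by rewrite ler_wpM2r// (le_trans ler01).
have -> : 128 * (64 * M) * (l * Num.sqrt l) = 16 * (l * (8 * (c * Num.sqrt l))).
  by rewrite /c; ring.
move: (l * (8 * _)) lA => z lA; lra.
Qed.

Lemma infratype_type (X : normedModType R) (M : R) n :
  (2 <= n)%N -> Vector.axiom n X -> 0 <= M -> infratype2_bound X M ->
  gaussian_type2_bound X (128 * (64 * M) * (ln n%:R `^ (3 / 2))).
Proof.
move=> n2 vX M0 infra m x d T P g ind gauss.
have M1 : 1 <= M.
  have [v2r lin_v2r [r2v v2rK r2vK]] := vX.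
  have n0 : (0 < n)%N by exact: ltnW.
  apply: (infratype_ge1 infra (x := r2v (delta_mx 0 (Ordinal n0)))).
  have v0 : v2r 0 = 0.
    by have := lin_v2r (-1) 0 0; rewrite scaler0 addr0 scaleN1r addNr.
  apply/eqP => /(congr1 v2r); rewrite r2vK v0.
  by move=> /rowP/(_ (Ordinal n0)); rewrite !mxE !eqxx/= => /eqP; rewrite oner_eq0.
set B := 128 * (64 * M) * _.
pose S := Num.sqrt (\sum_i `|x i| ^+ 2).
have sum0 : 0 <= \sum_i `|x i| ^+ 2 by apply: sumr_ge0 => i _; exact: sqr_ge0.
have S2 : S ^+ 2 = \sum_i `|x i| ^+ 2 by rewrite sqr_sqrtr.
have [S0|S0] := eqVneq S 0.
  have x0 i : x i = 0.
    have : \sum_i `|x i| ^+ 2 = 0 by rewrite -S2 S0 expr0n.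
    move=> /eqP; rewrite psumr_eq0; last by move=> j _; exact: sqr_ge0.
    by move=> /allP/(_ i (mem_index_enum _)); rewrite sqrf_eq0 normr_eq0 => /eqP.
  rewrite unlock -/S S0 mulr0 (eq_integral (cst 0%E)) ?integral0// => w _.
  by rewrite big1 ?normr0// => i _; rewrite x0 scaler0.
have S1 : 0 < S by rewrite lt_neqAle eq_sym S0 sqrtr_ge0.
have x1 : \sum_i `|S^-1 *: x i| ^+ 2 <= 1.
  under eq_bigr do rewrite normrZ exprMn ger0_norm ?invr_ge0 ?sqrtr_ge0//.
  by rewrite -mulr_sumr -S2 exprVn mulVf// expf_neq0.
have [Phi [mPhi Phi0 PhiP IPhi]] :=
  gaussian_norm_unit n2 vX infra M1 x1 ind gauss.
rewrite unlock -/S.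
apply: (@le_trans _ _ (\int[P]_w (S%:E * (Phi w)%:E))%E).
  apply: le_integral_pointwise => w; rewrite lee_fin//.
  have -> : \sum_i g i w *: x i = S *: \sum_i g i w *: (S^-1 *: x i).
    rewrite scaler_sumr; apply: eq_bigr => i _.
    by rewrite !scalerA mulrAC mulfV// mul1r.
  by rewrite normrZ ger0_norm ?(ltW S1)// ler_pM2l.
rewrite ge0_integralZl//=; last 3 first.
- exact/measurable_EFinP.
- by move=> w _; rewrite lee_fin.
- by rewrite lee_fin ltW.
by rewrite mulrC EFinM lee_pmul2l ?lte_fin.
Qed.

End Main.

Theorem mainTheorem4 (R : realType) :
  exists C : R, 0 < C /\
    forall (n : nat) (X : completeNormedModType R),
      (2 <= n)%N -> Vector.axiom n X ->
      (T2 X <= C%:E * I2 X * (ln n%:R `^ (3 / 2))%:E)%E.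
Proof.
have C0 : 0 < 128 * 64 :> R by lra.
exists (128 * 64); split=> // n X n2 vX.
set c : R := ln n%:R `^ (3 / 2).
have c0 : 0 < c by rewrite powR_gt0//; have := @ln_ge_half R n n2; lra.
have cC : 0 < c * (128 * 64) by exact: mulr_gt0.
rewrite muleC muleA -EFinM -lee_pdivrMl//.
apply: le_ereal_inf_tmp => _ [M [M0 infra] <-].
rewrite lee_pdivrMl// -EFinM.
apply: ereal_inf_lbound; exists (128 * (64 * M) * c); last by congr EFin; ring.
split; last exact: infratype_type.
by rewrite mulr_ge0 ?(ltW c0)//; lra.
Qed.
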